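(* There exists $\gamma>0$ such that the following holds for every $r\in(0,2+\gamma)$. Suppose that for all sufficiently small $\beta>0$ we are given an asymmetric solution $(\psi,A)=(\psi_\beta,A_\beta)$ on $[-m,M]=[-m(\beta),M(\beta)]$ with the properties listed in the context. Then for all sufficiently small $\beta>0$ the energy $$\mathcal G=\frac{\beta^2}{2(m+M)}\int_{-m}^{M}\Big(\psi^2\Big(\frac{\beta^2\psi^2}{2}-1+A^2\Big)+(\psi')^2+\frac{1}{r\beta^2}(A'-h)^2\Big)\,dt$$ satisfies $\mathcal G<0$.
   Context: The asymmetric solutions considered are as follows: for each sufficiently small $\beta>0$ there are $m=m(\beta)>0$, $M=M(\beta)>0$, $h=h(\beta)>1.6831$ and a pair $(\psi,A)$ on $[-m,M]$ with $$\psi''=\psi(\beta^2\psi^2+A^2-1),\qquad A''=r\beta^2\psi^2A,$$ $$\psi'(-m)=\psi'(M)=0,\qquad A'(-m)=A'(M)=h,\qquad \psi>0\text{ on }[-m,M],$$ and: (i) $m(\beta)\to0$ and $M(\beta)\to\infty$ as $\beta\to0^+$; (ii) $\psi'>0$ on $(-m,0)$, $\psi'(0)=0$, $\psi(0)=1$; (iii) $\psi'<0$ on $(0,M)$; (iv) there is $h^0>1.6831$ such that $A'(-m)\to h^0$ as $\beta\to0^+$. Primes denote derivatives with respect to $t$. *)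

(* Defs.v *)
From Stdlib Require Import Reals.
From Coquelicot Require Import Coquelicot.
Open Scope R_scope.

(** Derivatives on [[-m, M]] are taken relative to the interval with [D_in],
    hence one-sided at the two endpoints.  The functions [dpsi] and [dA] are
    the first derivatives; their values outside [[-m, M]] play no role. *)
Definition dom (m M t : R) : Prop := - m <= t <= M.

Record asymmetric_solution (r beta m M h : R) (psi dpsi A dA : R -> R) : Prop := {
  as_m_pos : 0 < m;
  as_M_pos : 0 < M;
  as_h_gt : 1.6831 < h;
  as_dpsi : forall t, dom m M t -> D_in psi dpsi (dom m M) t;
  as_dA : forall t, dom m M t -> D_in A dA (dom m M) t;
  as_ode_psi : forall t, dom m M t ->
    D_in dpsi (fun s => psi s * (beta ^ 2 * psi s ^ 2 + A s ^ 2 - 1)) (dom m M) t;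
  as_ode_A : forall t, dom m M t ->
    D_in dA (fun s => r * beta ^ 2 * psi s ^ 2 * A s) (dom m M) t;
  as_bc_psi_left : dpsi (- m) = 0;
  as_bc_psi_right : dpsi M = 0;
  as_bc_A_left : dA (- m) = h;
  as_bc_A_right : dA M = h;
  as_psi_pos : forall t, dom m M t -> 0 < psi t;
  as_psi_incr : forall t, - m < t < 0 -> 0 < dpsi t;
  as_dpsi_0 : dpsi 0 = 0;
  as_psi_0 : psi 0 = 1;
  as_psi_decr : forall t, 0 < t < M -> dpsi t < 0
}.

(** "For all sufficiently small [beta > 0]" is [at_right 0]. *)
Record asymmetric_family (r : R) (m M h : R -> R)
    (psi dpsi A dA : R -> R -> R) : Prop := {
  af_solution : at_right 0 (fun beta =>
    asymmetric_solution r beta (m beta) (M beta) (h beta)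
      (psi beta) (dpsi beta) (A beta) (dA beta));
  af_m_lim : filterlim m (at_right 0) (locally 0);
  af_M_lim : filterlim M (at_right 0) (Rbar_locally p_infty);
  af_h_lim : exists h0, 1.6831 < h0 /\
    filterlim (fun beta => dA beta (- m beta)) (at_right 0) (locally h0)
}.

Definition energy (r beta m M h : R) (psi dpsi A dA : R -> R) : R :=
  beta ^ 2 / (2 * (m + M)) *
  RInt (fun t =>
    psi t ^ 2 * (beta ^ 2 * psi t ^ 2 / 2 - 1 + A t ^ 2)
    + dpsi t ^ 2
    + 1 / (r * beta ^ 2) * (dA t - h) ^ 2) (- m) M.

(* Main.v *)
(** Write [s = beta^2], [B(t)] for the integral of [psi^2 A] over [[-m, t]], so that
    [A' - h = r s B], and [rho = 2.01].  As [(psi psi')' = psi'^2 + psi psi''], the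
    integral in the energy equals [s (r int B^2 - (1/2) int psi^4)].  The first
    integral of the system reads [B (A' + h) = psi psi'' - psi'^2 + o(1)]; combining
    it with two integrations by parts gives
      [2 h int B^2 <= (4 / (3 h)) int psi'^4 + (h int psi^4 - 1) / 4 + o(1)].
    As [beta -> 0], [A] is increasing with slope in [[h - O(s), h]] and
    [A(0) -> -1], so on the region [|A| <= 1] the equation for [psi] gives
    [|psi'| <= 4 / (3 h)], hence [int psi'^4 <= (4 / (3 h))^3], and
    [psi(1/h) >= 1 - 1 / (4 h^2)], hence a lower bound for [int psi^4].  Since
    [h > 1.6831], these bounds leave room for [r] slightly above [2].  The error terms
    on the long interval are controlled by the integral of [-B], which is bounded
    uniformly in [M].

    All functions are extended by constants outside [[-m, M]], which makes them
    continuous on the line. *)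
Require Import Defs.
From Stdlib Require Import Reals Lra Lia Psatz.
From Coquelicot Require Import Coquelicot.
Open Scope R_scope.

(** * Monotonicity from derivatives *)

(** Derivatives are asked for only in the open interval: at [- m] and [M] the solution has one-sided
    derivatives, and continuity carries the conclusion to the ends. *)
Lemma nondecreasing_of_derive (f df : R -> R) (a b : R) :
  a <= b ->
  (forall t, a <= t <= b -> continuity_pt f t) ->
  (forall t, a < t < b -> is_derive f t (df t)) ->
  (forall t, a < t < b -> 0 <= df t) ->
  f a <= f b.
Proof.
intros Hab Hc Hd Hp.
destruct (Req_dec a b) as [<-|Hne]; [lra|].
assert (pr : forall c, a < c < b -> derivable_pt f c).
{ intros c Hcc; exists (df c); apply is_derive_Reals; auto. }
assert (pr2 : forall c, a < c < b -> derivable_pt id c).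
{ intros; apply derivable_pt_id. }
destruct (MVT f id a b pr pr2) as [c [Pc E]]; [lra|auto| |].
{ intros; apply derivable_continuous_pt, derivable_pt_id. }
rewrite (derive_pt_eq_0 f c (df c)) in E by (apply is_derive_Reals; auto).
rewrite (derive_pt_eq_0 id c 1) in E by (apply derivable_pt_lim_id).
unfold id in E. specialize (Hp c Pc). nra.
Qed.

Lemma constant_of_derive (f : R -> R) (a b : R) :
  a <= b ->
  (forall t, a <= t <= b -> continuity_pt f t) ->
  (forall t, a < t < b -> is_derive f t 0) ->
  f a = f b.
Proof.
intros Hab Hc Hd; apply Rle_antisym.
- apply (nondecreasing_of_derive f (fun _ => 0)); auto; intros; lra.
- apply Ropp_le_cancel.
  apply (nondecreasing_of_derive (fun t => - f t) (fun _ => 0)); auto.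
  + intros; apply continuity_pt_opp; auto.
  + intros t Ht; rewrite <- Ropp_0; apply (is_derive_opp f); auto.
  + intros; lra.
Qed.

Lemma continuity_pt_pow (f : R -> R) (n : nat) (t : R) :
  continuity_pt f t -> continuity_pt (fun x => f x ^ n) t.
Proof.
intros Hf; induction n as [|n IH]; simpl.
- apply continuity_pt_const; intros x y; reflexivity.
- apply (continuity_pt_mult f); auto.
Qed.

(** * Extension of the solution to the whole line *)

Definition clamp (a b t : R) : R := Rmax a (Rmin t b).

Lemma clamp_bounds (a b t : R) : a <= b -> a <= clamp a b t <= b.
Proof. unfold clamp, Rmax, Rmin; intros; repeat destruct Rle_dec; lra. Qed.

Lemma clamp_id (a b t : R) : a <= t <= b -> clamp a b t = t.
Proof. unfold clamp, Rmax, Rmin; intros; repeat destruct Rle_dec; lra. Qed.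

Lemma clamp_lipschitz (a b t u : R) :
  a <= b -> Rabs (clamp a b t - clamp a b u) <= Rabs (t - u).
Proof.
unfold clamp, Rmax, Rmin, Rabs; intros.
repeat destruct Rle_dec; repeat destruct Rcase_abs; lra.
Qed.

Lemma clamp_continuity (m M : R) (f df : R -> R) :
  - m <= M ->
  (forall t, dom m M t -> D_in f df (dom m M) t) ->
  forall t, continuity_pt (fun x => f (clamp (- m) M x)) t.
Proof.
intros HmM Hf t eps Heps.
destruct (cont_deriv _ _ _ _ (Hf _ (clamp_bounds _ _ t HmM)) eps Heps)
  as [d [Hd H]].
exists d; split; [exact Hd|].
intros x [_ Hx].
(* Limits in [cont_deriv] exclude the base point itself, so coinciding clamped points are treated
   apart. *)
destruct (Req_dec (clamp (- m) M t) (clamp (- m) M x)) as [E|E].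
- rewrite E; simpl; unfold R_dist; rewrite Rminus_diag, Rabs_R0; exact Heps.
- apply (H (clamp (- m) M x)); split.
  + split; [apply clamp_bounds, HmM|exact E].
  + eapply Rle_lt_trans; [|exact Hx]; apply clamp_lipschitz, HmM.
Qed.

Lemma clamp_is_derive (m M : R) (f df : R -> R) (t : R) :
  - m < t < M ->
  D_in f df (dom m M) t ->
  is_derive (fun x => f (clamp (- m) M x)) t (df t).
Proof.
intros Ht Hf; apply is_derive_Reals.
intros eps Heps.
destruct (Hf eps Heps) as [d [Hd H]].
assert (Hd' : 0 < Rmin d (Rmin (t + m) (M - t))) by (repeat apply Rmin_pos; lra).
exists (mkposreal _ Hd'); intros k Hk Hkd; simpl in Hkd.
assert (Hk1 : Rabs k < d) by (eapply Rlt_le_trans; [apply Hkd|apply Rmin_l]).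
assert (Hk2 : Rabs k < t + m).
{ eapply Rlt_le_trans; [apply Hkd|].
  eapply Rle_trans; [apply Rmin_r|apply Rmin_l]. }
assert (Hk3 : Rabs k < M - t).
{ eapply Rlt_le_trans; [apply Hkd|].
  eapply Rle_trans; [apply Rmin_r|apply Rmin_r]. }
apply Rabs_def2 in Hk2; apply Rabs_def2 in Hk3.
rewrite !clamp_id by lra.
specialize (H (t + k)); simpl in H; unfold R_dist in H.
replace (t + k - t) with k in H by ring.
apply H; split; [split; [split|]|]; lra.
Qed.

(* [s] stands for [beta^2]; the bounds on [s], [h * m] and [M] make "small
   [beta]" quantitative. *)
Record clamped_solution (r s m M h : R) (psi dpsi A dA : R -> R) : Prop := {
  cs_r : 0 < r < 2.01;
  cs_s : 0 < s <= 1e-5;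
  cs_m : 0 < m;
  cs_hm : h * m <= 1e-5;
  cs_M : 1 <= M;
  cs_h : 1.6831 < h;
  cs_psi_cont : forall t, continuity_pt psi t;
  cs_dpsi_cont : forall t, continuity_pt dpsi t;
  cs_A_cont : forall t, continuity_pt A t;
  cs_dA_cont : forall t, continuity_pt dA t;
  cs_psi : forall t, - m < t < M -> is_derive psi t (dpsi t);
  cs_dpsi : forall t, - m < t < M ->
    is_derive dpsi t (psi t * (s * psi t ^ 2 + A t ^ 2 - 1));
  cs_A : forall t, - m < t < M -> is_derive A t (dA t);
  cs_dA : forall t, - m < t < M -> is_derive dA t (r * s * psi t ^ 2 * A t);
  cs_dpsi_left : dpsi (- m) = 0;
  cs_dpsi_right : dpsi M = 0;
  cs_dA_left : dA (- m) = h;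
  cs_dA_right : dA M = h;
  cs_pos : forall t, - m <= t <= M -> 0 < psi t;
  cs_incr : forall t, - m < t < 0 -> 0 < dpsi t;
  cs_dpsi_0 : dpsi 0 = 0;
  cs_psi_0 : psi 0 = 1;
  cs_decr : forall t, 0 < t < M -> dpsi t < 0
}.

Lemma clamped_solution_of_asymmetric (r beta m M h : R) (psi dpsi A dA : R -> R) :
  0 < r < 2.01 -> 0 < beta -> beta ^ 2 <= 1e-5 -> h * m <= 1e-5 -> 1 <= M ->
  asymmetric_solution r beta m M h psi dpsi A dA ->
  clamped_solution r (beta ^ 2) m M h
    (fun t => psi (clamp (- m) M t)) (fun t => dpsi (clamp (- m) M t))
    (fun t => A (clamp (- m) M t)) (fun t => dA (clamp (- m) M t)).
Proof.
intros Hr Hb Hs Hhm HM [m_pos M_pos h_gt D1 D2 D3 D4 B1 B2 B3 B4 P1 P2 P3 P4 P5].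
assert (HmM : - m <= M) by lra.
constructor; try assumption; try (rewrite clamp_id by lra; assumption).
- split; [apply pow_lt, Hb|exact Hs].
- apply (clamp_continuity _ _ psi dpsi); auto.
- eapply clamp_continuity; eauto.
- eapply clamp_continuity; eauto.
- eapply clamp_continuity; eauto.
- intros t Ht; rewrite clamp_id by lra.
  apply (clamp_is_derive m M psi dpsi); auto; apply D1; unfold dom; lra.
- intros t Ht; rewrite clamp_id by lra.
  apply (clamp_is_derive m M dpsi
    (fun s => psi s * (beta ^ 2 * psi s ^ 2 + A s ^ 2 - 1))); auto.
  apply D3; unfold dom; lra.
- intros t Ht; rewrite clamp_id by lra.
  apply (clamp_is_derive m M A dA); auto; apply D2; unfold dom; lra.
- intros t Ht; rewrite clamp_id by lra.
  apply (clamp_is_derive m M dA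
    (fun s => r * beta ^ 2 * psi s ^ 2 * A s)); auto.
  apply D4; unfold dom; lra.
- intros t Ht; rewrite clamp_id by lra; apply P1; unfold dom; lra.
- intros t Ht; rewrite clamp_id by lra; auto.
- intros t Ht; rewrite clamp_id by lra; auto.
Qed.

Lemma exists_derive_zero (f df : R -> R) (a b : R) :
  a < b ->
  (forall t, a <= t <= b -> continuity_pt f t) ->
  (forall t, a < t < b -> is_derive f t (df t)) ->
  f a = f b -> exists c, a < c < b /\ df c = 0.
Proof.
intros Hab Hc Hd E.
assert (pr : forall c, a < c < b -> derivable_pt f c).
{ intros c Hcc; exists (df c); apply is_derive_Reals; auto. }
destruct (Rolle f a b pr Hc Hab E) as [c [Pc E0]].
exists c; split; [exact Pc|].
rewrite <- E0; symmetry; apply derive_pt_eq_0, is_derive_Reals; auto.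
Qed.

Tactic Notation "instantiate_fact" ident(X) constr(L) :=
  pose proof L as X;
  repeat match type of X with
  | ?P -> _ => let H := fresh in assert (H : P) by lra; specialize (X H); clear H
  end.

Ltac continuity_tac :=
  intros;
  match goal with
  | |- continuity_pt (fun x => @?f x + @?g x) _ =>
      apply (continuity_pt_plus f g); continuity_tac
  | |- continuity_pt (fun x => @?f x - @?g x) _ =>
      apply (continuity_pt_minus f g); continuity_tac
  | |- continuity_pt (fun x => - @?f x) _ =>
      apply (continuity_pt_opp f); continuity_tac
  | |- continuity_pt (fun x => @?f x * @?g x) _ =>
      apply (continuity_pt_mult f g); continuity_tac
  | |- continuity_pt (fun x => @?f x / ?c) _ =>
      apply (continuity_pt_mult f (fun _ => / c)); continuity_tac
  | |- continuity_pt (fun x => @?f x ^ ?n) _ =>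
      apply (continuity_pt_pow f n); continuity_tac
  | |- continuity_pt (fun x => atan (@?f x)) _ =>
      apply (continuity_pt_comp f atan);
      [continuity_tac|apply derivable_continuous_pt, derivable_pt_atan]
  | |- continuity_pt (fun x => x) _ =>
      apply derivable_continuous_pt, derivable_pt_id
  | |- continuity_pt (fun _ => ?c) _ =>
      apply continuity_pt_const; intros ? ?; reflexivity
  | H : clamped_solution _ _ _ _ _ _ _ _ _ |- continuity_pt _ _ =>
      first [ apply (cs_psi_cont _ _ _ _ _ _ _ _ _ H)
            | apply (cs_dpsi_cont _ _ _ _ _ _ _ _ _ H)
            | apply (cs_A_cont _ _ _ _ _ _ _ _ _ H)
            | apply (cs_dA_cont _ _ _ _ _ _ _ _ _ H) ]
  end.

(* Leaves the equality between the computed and the stated derivative. *)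
Ltac derive_tac :=
  match goal with
  | S : clamped_solution _ _ ?m ?M _ ?p ?dp ?A ?dA |- is_derive _ ?t _ =>
    let Ht := fresh in
    assert (Ht : - m < t < M) by lra;
    let D1 := fresh "D" in let D2 := fresh "D" in
    let D3 := fresh "D" in let D4 := fresh "D" in
    pose proof (cs_psi _ _ _ _ _ _ _ _ _ S t Ht) as D1;
    pose proof (cs_dpsi _ _ _ _ _ _ _ _ _ S t Ht) as D2;
    pose proof (cs_A _ _ _ _ _ _ _ _ _ S t Ht) as D3;
    pose proof (cs_dA _ _ _ _ _ _ _ _ _ S t Ht) as D4;
    auto_derive;
    [ repeat split; try (eexists; eassumption)
    | rewrite ?(is_derive_unique (fun u : R => p u) _ _ D1),
        ?(is_derive_unique (fun u : R => dp u) _ _ D2),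
        ?(is_derive_unique (fun u : R => A u) _ _ D3),
        ?(is_derive_unique (fun u : R => dA u) _ _ D4) ]
  end.

(** * Integrals of continuous functions *)

Lemma ex_RInt_continuity (f : R -> R) (a b : R) :
  (forall t, continuity_pt f t) -> ex_RInt f a b.
Proof.
intros Hf; apply (ex_RInt_continuous (V := R_CompleteNormedModule)); intros z _.
apply continuity_pt_filterlim; auto.
Qed.

Lemma is_derive_RInt_continuity (f : R -> R) (a t : R) :
  (forall t, continuity_pt f t) -> is_derive (RInt f a) t (f t).
Proof.
intros Hf; apply is_derive_RInt with a.
- apply filter_forall; intros y.
  apply (RInt_correct (V := R_CompleteNormedModule)), ex_RInt_continuity, Hf.
- apply continuity_pt_filterlim; auto.
Qed.

(** Vehicle for the integrations by parts: [F] is a primitive guessed in advance, and [F - RInt g a]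
    is nondecreasing, so the integral of [f] is never formed. *)
Lemma RInt_le_of_derive (F f g : R -> R) (a b : R) :
  a <= b ->
  (forall t, continuity_pt F t) ->
  (forall t, continuity_pt g t) ->
  (forall t, a < t < b -> is_derive F t (f t)) ->
  (forall t, a < t < b -> g t <= f t) ->
  RInt g a b <= F b - F a.
Proof.
intros Hab HF Hg Hd Hle.
assert (HI := fun t => is_derive_RInt_continuity g a t Hg).
assert (E : F a - RInt g a a <= F b - RInt g a b).
{ apply (nondecreasing_of_derive (fun t => F t - RInt g a t)
    (fun t => f t - g t)); auto.
  - intros t _; apply continuity_pt_minus; auto.
    apply derivable_continuous_pt; exists (g t); apply is_derive_Reals, HI.
  - intros t Ht; apply (is_derive_minus F (RInt g a)); auto.
  - intros t Ht; specialize (Hle t Ht); lra. }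
rewrite RInt_point in E; change zero with 0 in E; lra.
Qed.

(** * Pointwise and numerical inequalities *)

(* [b, p, d, a1, q, c] stand for [B, psi, psi', A', psi''/psi, s psi^4/2 - K]. *)
Lemma B_square_bound (r rho u k h b p d a1 q c : R) :
  0 < r -> r <= rho -> 0 < u -> u <= a1 + h -> a1 <= h -> b <= 0 -> c <= k ->
  b * (a1 + h) = p ^ 2 * q - d ^ 2 - c ->
  r * b ^ 2 <=
    rho / u * (b * (d ^ 2 + p ^ 2 * q) - p ^ 4 * a1 / 4
               - 2 / u * (d ^ 4 / 3 + p ^ 2 * q * d ^ 2)
               + (2 / u * (4 / 3 * d ^ 4 + k * d ^ 2) + p ^ 4 * h / 4 - k * b)).
Proof.
intros Hr Hrho Hu Hu1 Ha Hb Hc E.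
assert (Hp : 0 <= p ^ 4)
  by (replace (p ^ 4) with ((p ^ 2) ^ 2) by ring; apply pow2_ge_0).
assert (Hd : 0 <= d ^ 2) by apply pow2_ge_0.
assert (Hb2 : 0 <= b ^ 2) by apply pow2_ge_0.
set (X := _ - _ + _).
(* The first integral [E] gives [b * (p^2 q - d^2) = b * (d^2 + p^2 q) + 2 d^2 (- b)]; the first
   summand belongs to an exact derivative, and [H2] bounds the second by using [E] once more through
   [H1]. *)
assert (HX : b ^ 2 * u <= X).
{ apply Rle_trans with (b ^ 2 * (a1 + h)); [nra|].
  replace (b ^ 2 * (a1 + h)) with (b * (b * (a1 + h))) by ring; rewrite E.
  assert (H1 : - b <= / u * (d ^ 2 - p ^ 2 * q + k)).
  { apply Rmult_le_reg_l with u; [exact Hu|].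
    rewrite <- Rmult_assoc, Rinv_r, Rmult_1_l by lra. nra. }
  assert (H2 : 2 * d ^ 2 * (- b) <= 2 * d ^ 2 * (/ u * (d ^ 2 - p ^ 2 * q + k))).
  { apply Rmult_le_compat_l; lra. }
  assert (H3 : - b * c <= - b * k) by (apply Rmult_le_compat_l; lra).
  assert (H4 : 0 <= p ^ 4 * (h - a1)) by (apply Rmult_le_pos; lra).
  unfold X, Rdiv. lra. }
apply Rle_trans with (rho / u * (b ^ 2 * u)).
- replace (rho / u * (b ^ 2 * u)) with (rho * b ^ 2) by (field; lra). nra.
- apply Rmult_le_compat_l; [|exact HX].
  apply Rmult_le_pos; [lra|apply Rlt_le, Rinv_0_lt_compat, Hu].
Qed.

(* The only place where the lower bound on [h] is decisive.  Up to small errors,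
   [I4 <= (4 / (3 h))^3] and [Q >= (1 - 1 / (4 h^2))^4 / h], and at [h = 1.6831]
   the two sides differ by about 6 percent. *)
Lemma final_numeric_bound (s m h u I4 I2 IB Q P : R) :
  0 < s <= 1e-5 -> 0 < m <= 1e-5 -> 1.6831 < h -> u = 2 * h - 5 * s ->
  I4 <= m + 0.7923 ^ 3 -> I2 <= m + 0.7923 -> IB <= 25 ->
  0.9117 ^ 4 / h <= Q -> P <= - (1 - m) ^ 4 * (1 - s) ->
  2.01 / u * (P / 4 + 2 / u * (4 / 3 * I4 + 1e-4 * I2) + 1e-4 * IB)
  + (2.01 / u * (h / 4) - 1 / 2) * Q < 0.
Proof.
intros Hs Hm Hh Hu H4 H2 HB HQ HP.
assert (Hu0 : 3.366 <= u) by lra.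
assert (HP' : P <= - 0.9998).
{ assert (0.99999 <= 1 - m <= 1) by lra.
  assert (0.99996 <= (1 - m) ^ 4).
  { apply Rle_trans with (0.99999 ^ 4); [lra|apply pow_incr; lra]. }
  assert ((1 - m) ^ 4 <= 1).
  { apply Rle_trans with (1 ^ 4); [apply pow_incr; lra|lra]. }
  nra. }
assert (H2u : 0 < 2 / u <= 2 / 3.366).
{ split; [apply Rdiv_lt_0_compat; lra|].
  apply Rmult_le_compat_l; [lra|apply Rinv_le_contravar; lra]. }
assert (HQ' : 0.6908 <= h * Q).
{ apply Rle_trans with (0.9117 ^ 4); [lra|].
  replace (0.9117 ^ 4) with (h * (0.9117 ^ 4 / h)) by (field; lra).
  apply Rmult_le_compat_l; lra. }
assert (HQp : 0 < Q) by nra.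
assert (HX : P / 4 + 2 / u * (4 / 3 * I4 + 1e-4 * I2) + 1e-4 * IB <= 0.148).
{ assert (2 / u * (4 / 3 * I4 + 1e-4 * I2) <= 2 / u * 0.6635).
  { apply Rmult_le_compat_l; lra. }
  nra. }
(* After multiplication by [u] the coefficient of [Q] is about [- 0.4975 h], and
   [2.01 * 0.148 < 0.4975 * 0.6908] with room for the term in [s]. *)
apply Rmult_lt_reg_l with u; [lra|].
rewrite Rmult_0_r.
set (X := _ + 1e-4 * IB) in *.
replace (u * (2.01 / u * X + (2.01 / u * (h / 4) - 1 / 2) * Q))
  with (2.01 * X + (2.01 * h / 4 - u / 2) * Q) by (field; lra).
rewrite Hu. nra.
Qed.

(* [flux t] is the integral of [psi^2 A] over [[-m, t]]. *)
Definition flux (r s h : R) (dA : R -> R) (t : R) : R := (dA t - h) / (r * s).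

Section Estimates.

Context (r s m M h : R) (psi dpsi A dA : R -> R)
  (S : clamped_solution r s m M h psi dpsi A dA).

Let r_bounds := cs_r _ _ _ _ _ _ _ _ _ S.
Let s_bounds := cs_s _ _ _ _ _ _ _ _ _ S.
Let m_pos := cs_m _ _ _ _ _ _ _ _ _ S.
Let hm_small := cs_hm _ _ _ _ _ _ _ _ _ S.
Let M_large := cs_M _ _ _ _ _ _ _ _ _ S.
Let h_gt := cs_h _ _ _ _ _ _ _ _ _ S.

Let m_small : m <= 1e-5.
Proof. nra. Qed.

(** * Sign of [A] and bounds on its slope *)

(** Rolle applies to [dA], equal to [h] at both ends; the factor [r s psi^2] of its derivative is
    positive. *)
Lemma A_zero : exists z, - m < z < M /\ A z = 0.
Proof.
destruct (exists_derive_zero dA (fun t => r * s * psi t ^ 2 * A t) (- m) M)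
  as [z [Hz E]].
- lra.
- continuity_tac.
- apply (cs_dA _ _ _ _ _ _ _ _ _ S).
- rewrite (cs_dA_left _ _ _ _ _ _ _ _ _ S); symmetry.
  apply (cs_dA_right _ _ _ _ _ _ _ _ _ S).
- exists z; split; [exact Hz|].
  assert (P : 0 < psi z) by (apply (cs_pos _ _ _ _ _ _ _ _ _ S); lra).
  assert (Q : 0 < r * s * psi z ^ 2).
  { repeat apply Rmult_lt_0_compat; try lra; simpl; lra. }
  nra.
Qed.

(** The derivative of [A A'] is a sum of squares with nonnegative weights, so [A^2] can be
    controlled before the sign of [A'] is known. *)
Lemma A_dA_nondecreasing x y :
  - m <= x -> x <= y -> y <= M -> A x * dA x <= A y * dA y.
Proof.
intros Hx Hxy Hy.
apply (nondecreasing_of_derive (fun t => A t * dA t)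
  (fun t => dA t ^ 2 + r * s * psi t ^ 2 * A t ^ 2)); try lra.
- continuity_tac.
- intros t Ht; derive_tac; ring.
- intros t Ht.
  assert (0 <= r * s * (psi t * A t) ^ 2).
  { apply Rmult_le_pos; [nra|apply pow2_ge_0]. }
  nra.
Qed.

(** [A A'] vanishes at [z], so [A^2] decreases before [z] and increases after it. As [A' = h > 0] at
    the ends, [A] has the right sign there; a wrong sign at [t] would give a zero between [t] and
    that end, and monotonicity of [A^2] would force [A t = 0]. *)
Lemma A_sign : exists z, - m < z < M /\ A z = 0 /\
  (forall t, - m <= t <= z -> A t <= 0) /\ (forall t, z <= t <= M -> 0 <= A t) /\
  (forall t, - m <= t <= z -> A t ^ 2 <= A (- m) ^ 2).
Proof.
destruct A_zero as [z [Hz E]]; exists z; split; [exact Hz|split; [exact E|]].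
instantiate_fact HdA1 (cs_dA_left _ _ _ _ _ _ _ _ _ S).
instantiate_fact HdA2 (cs_dA_right _ _ _ _ _ _ _ _ _ S).
assert (N : forall x y, - m <= x -> x <= y -> y <= z -> A y ^ 2 <= A x ^ 2).
{ intros x y Hx Hxy Hy; apply Ropp_le_cancel.
  apply (nondecreasing_of_derive (fun t => - A t ^ 2)
    (fun t => - 2 * (A t * dA t))); try lra.
  - continuity_tac.
  - intros t Ht; derive_tac; ring.
  - intros t Ht; assert (A t * dA t <= A z * dA z).
    { apply A_dA_nondecreasing; lra. }
    rewrite E in H; lra. }
assert (P : forall x y, z <= x -> x <= y -> y <= M -> A x ^ 2 <= A y ^ 2).
{ intros x y Hx Hxy Hy.
  apply (nondecreasing_of_derive (fun t => A t ^ 2)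
    (fun t => 2 * (A t * dA t))); try lra.
  - continuity_tac.
  - intros t Ht; derive_tac; ring.
  - intros t Ht; assert (A z * dA z <= A t * dA t).
    { apply A_dA_nondecreasing; lra. }
    rewrite E in H; lra. }
assert (HA : continuity A) by (intros t; continuity_tac).
split; [|split].
- intros t Ht; apply Rnot_lt_le; intros Hlt.
  assert (HL : A (- m) * dA (- m) <= A z * dA z).
  { apply A_dA_nondecreasing; lra. }
  rewrite E, HdA1 in HL.
  destruct (IVT_cor A (- m) t HA) as [c [Hc Ec]]; [lra|nra|].
  instantiate_fact X (N c t); rewrite Ec in X; nra.
- intros t Ht; apply Rnot_lt_le; intros Hlt.
  assert (HL : A z * dA z <= A M * dA M).
  { apply A_dA_nondecreasing; lra. }
  rewrite E, HdA2 in HL.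
  destruct (IVT_cor A t M HA) as [c [Hc Ec]]; [lra|nra|].
  instantiate_fact X (P t c); rewrite Ec in X; nra.
- intros t Ht; apply N; lra.
Qed.

Lemma psi_le_1 t : - m <= t <= M -> psi t <= 1.
Proof.
intros Ht; rewrite <- (cs_psi_0 _ _ _ _ _ _ _ _ _ S).
destruct (Rle_dec t 0) as [H0|H0].
- apply (nondecreasing_of_derive psi dpsi); try lra.
  + continuity_tac.
  + intros u Hu; apply (cs_psi _ _ _ _ _ _ _ _ _ S); lra.
  + intros u Hu; apply Rlt_le, (cs_incr _ _ _ _ _ _ _ _ _ S); lra.
- apply Ropp_le_cancel.
  apply (nondecreasing_of_derive (fun u => - psi u) (fun u => - dpsi u)); try lra.
  + continuity_tac.
  + intros u Hu; derive_tac; ring.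
  + intros u Hu; instantiate_fact X (cs_decr _ _ _ _ _ _ _ _ _ S u); lra.
Qed.

Lemma psi_pos t : - m <= t <= M -> 0 < psi t.
Proof. apply (cs_pos _ _ _ _ _ _ _ _ _ S). Qed.

Lemma psi2_bounds t : - m <= t <= M -> 0 < psi t ^ 2 <= 1.
Proof. intros Ht; assert (X := psi_le_1 t Ht); assert (Y := psi_pos t Ht); nra. Qed.

(** [A''] has the sign of [A], so [A'] first descends from [h] and then climbs back to [h]. *)
Lemma dA_le_h t : - m <= t <= M -> dA t <= h.
Proof.
intros Ht; destruct A_sign as [z [Hz [E [N [P _]]]]].
destruct (Rle_dec t z) as [Hl|Hl].
- rewrite <- (cs_dA_left _ _ _ _ _ _ _ _ _ S); apply Ropp_le_cancel.
  apply (nondecreasing_of_derive (fun u => - dA u)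
    (fun u => - (r * s * psi u ^ 2 * A u))); try lra.
  + continuity_tac.
  + intros u Hu; derive_tac; ring.
  + intros u Hu; instantiate_fact X (psi2_bounds u); instantiate_fact Y (N u).
    assert (0 <= r * s * psi u ^ 2) by (apply Rmult_le_pos; nra). nra.
- rewrite <- (cs_dA_right _ _ _ _ _ _ _ _ _ S).
  apply (nondecreasing_of_derive dA (fun u => r * s * psi u ^ 2 * A u)); try lra.
  + continuity_tac.
  + intros u Hu; derive_tac; ring.
  + intros u Hu; instantiate_fact X (psi2_bounds u); instantiate_fact Y (P u).
    assert (0 <= r * s * psi u ^ 2) by (apply Rmult_le_pos; nra). nra.
Qed.

Lemma A_increment_le x y :
  - m <= x -> x <= y -> y <= M -> A y - A x <= h * (y - x).
Proof.
intros Hx Hxy Hy.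
assert (h * x - A x <= h * y - A y); [|lra].
apply (nondecreasing_of_derive (fun u => h * u - A u) (fun u => h - dA u)); try lra.
- continuity_tac.
- intros u Hu; derive_tac; ring.
- intros u Hu; instantiate_fact X (dA_le_h u); lra.
Qed.

(* Rolle's theorem for [psi'], which vanishes at both ends of [[-m, 0]]. *)
Lemma A_unit_point : exists xi, - m < xi < 0 /\ 1 - s <= A xi ^ 2 <= 1.
Proof.
destruct (exists_derive_zero dpsi
  (fun t => psi t * (s * psi t ^ 2 + A t ^ 2 - 1)) (- m) 0) as [z [Hz E]].
- lra.
- continuity_tac.
- intros t Ht; apply (cs_dpsi _ _ _ _ _ _ _ _ _ S); lra.
- rewrite (cs_dpsi_left _ _ _ _ _ _ _ _ _ S); symmetry.
  apply (cs_dpsi_0 _ _ _ _ _ _ _ _ _ S).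
- exists z; split; [exact Hz|].
  instantiate_fact X (psi_pos z); instantiate_fact Y (psi2_bounds z).
  assert (s * psi z ^ 2 + A z ^ 2 - 1 = 0).
  { apply Rmult_integral in E; destruct E; lra. }
  nra.
Qed.

Lemma A_left_ge : - 1 - h * m <= A (- m) <= 0.
Proof.
destruct A_sign as [z [Hz [E [N _]]]].
destruct A_unit_point as [x [Hx Hx2]].
instantiate_fact X (A_increment_le (- m) x).
instantiate_fact Y (N (- m)).
split; [|lra].
assert (- 1 <= A x) by nra.
assert (h * (x - - m) <= h * m) by (apply Rmult_le_compat_l; lra).
lra.
Qed.

(** [A'] is least at the zero [z] of [A]. Before [z] it falls at rate at most [2.3 s], since
    [A >= -1.1] and [r < 2.01]; and [z] is within 2 of [- m], because a slope above 1.6 would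
    otherwise make [A] positive too early. The loss is at most [4.6 s]. *)
Lemma dA_ge t : - m <= t <= M -> h - 5 * s <= dA t.
Proof.
intros Ht; destruct A_sign as [z [Hz [E [N [P Q]]]]].
instantiate_fact HL (A_left_ge).
assert (HA : forall t, - m <= t <= z -> - 1.1 <= A t).
{ intros u Hu; instantiate_fact X (Q u Hu); nra. }
assert (W : forall x, - m <= x <= z -> h - 2.3 * s * (x + m) <= dA x).
{ intros x Hx.
  assert (dA (- m) + 2.3 * s * (- m) <= dA x + 2.3 * s * x);
    [|rewrite (cs_dA_left _ _ _ _ _ _ _ _ _ S) in H; lra].
  apply (nondecreasing_of_derive (fun u => dA u + 2.3 * s * u)
    (fun u => r * s * psi u ^ 2 * A u + 2.3 * s)); try lra.
  - continuity_tac.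
  - intros u Hu; derive_tac; ring.
  - intros u Hu; instantiate_fact X (HA u); instantiate_fact Y (N u).
    instantiate_fact Z (psi2_bounds u).
    assert (- 2.3 <= r * (psi u ^ 2 * A u)); [|nra].
    assert (- 1.1 <= psi u ^ 2 * A u <= 0); nra. }
assert (Hz2 : z + m <= 2).
{ apply Rnot_lt_le; intros Hlt.
  assert (A (- m) - 1.6 * (- m) <= A (2 - m) - 1.6 * (2 - m)).
  { apply (nondecreasing_of_derive (fun u => A u - 1.6 * u)
      (fun u => dA u - 1.6)); try lra.
    - continuity_tac.
    - intros u Hu; derive_tac; ring.
    - intros u Hu; instantiate_fact X (W u); nra. }
  instantiate_fact X (N (2 - m)). lra. }
assert (Wz : h - 5 * s <= dA z) by (instantiate_fact X (W z); nra).
destruct (Rle_dec t z) as [Hl|Hl].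
- instantiate_fact X (W t); nra.
- apply Rle_trans with (1 := Wz).
  apply (nondecreasing_of_derive dA (fun u => r * s * psi u ^ 2 * A u)); try lra.
  + continuity_tac.
  + intros u Hu; derive_tac; ring.
  + intros u Hu; instantiate_fact X (psi2_bounds u); instantiate_fact Y (P u).
    assert (0 <= r * s * psi u ^ 2) by (apply Rmult_le_pos; nra). nra.
Qed.

Lemma A_increment_ge x y :
  - m <= x -> x <= y -> y <= M -> (h - 5 * s) * (y - x) <= A y - A x.
Proof.
intros Hx Hxy Hy.
assert (A x - (h - 5 * s) * x <= A y - (h - 5 * s) * y); [|lra].
apply (nondecreasing_of_derive (fun u => A u - (h - 5 * s) * u)
  (fun u => dA u - (h - 5 * s))); try lra.
- continuity_tac.
- intros u Hu; derive_tac; ring.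
- intros u Hu; instantiate_fact X (dA_ge u); lra.
Qed.

(** [A (- m) <= 0] and a rise of at most [h m] exclude the positive root. *)
Lemma A_unit_point_neg : exists xi, - m < xi < 0 /\ - 1 <= A xi <= - (1 - s).
Proof.
destruct A_unit_point as [x [Hx Hx2]]; exists x; split; [exact Hx|].
instantiate_fact X (A_increment_le (- m) x).
instantiate_fact HL (A_left_ge).
assert (h * (x - - m) <= 1e-5) by nra.
assert (A x <= 1e-5) by lra.
nra.
Qed.

Lemma A_left_bounds : - 1 - h * m <= A (- m) <= - (1 - s).
Proof.
split; [apply A_left_ge|].
destruct A_unit_point_neg as [x [Hx Hx2]].
instantiate_fact X (A_increment_ge (- m) x). nra.
Qed.

Lemma A_0_bounds : - 1 <= A 0 <= - (1 - s) + h * m.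
Proof.
destruct A_unit_point_neg as [x [Hx Hx2]].
instantiate_fact X (A_increment_ge x 0).
instantiate_fact Y (A_increment_le x 0). nra.
Qed.

(** * Bounds on [psi] and its derivative *)

(** 1.683 is a round value below [1.6831 - 5 s]. *)
Let A_ge' x y : - m <= x -> x <= y -> y <= M -> 1.683 * (y - x) <= A y - A x.
Proof. intros; instantiate_fact X (A_increment_ge x y); nra. Qed.

Let psi_bounds t : - m <= t <= M -> 0 < psi t <= 1.
Proof. split; [apply psi_pos|apply psi_le_1]; assumption. Qed.

(** As [0 < psi <= 1], one has [psi'' >= - 1], while [psi'] is back to 0 at 0; so
    [psi' <= - t <= m]. *)
Lemma dpsi_left t : - m <= t <= 0 -> 0 <= dpsi t <= 1.
Proof.
intros Ht; split.
- destruct (Req_dec t (- m)) as [->|H1].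
  { rewrite (cs_dpsi_left _ _ _ _ _ _ _ _ _ S); lra. }
  destruct (Req_dec t 0) as [->|H2].
  { rewrite (cs_dpsi_0 _ _ _ _ _ _ _ _ _ S); lra. }
  apply Rlt_le, (cs_incr _ _ _ _ _ _ _ _ _ S); lra.
- assert (dpsi t + t <= dpsi 0 + 0);
    [|rewrite (cs_dpsi_0 _ _ _ _ _ _ _ _ _ S) in H; lra].
  apply (nondecreasing_of_derive (fun u => dpsi u + u)
    (fun u => psi u * (s * psi u ^ 2 + A u ^ 2 - 1) + 1)); try lra.
  + continuity_tac.
  + intros u Hu; derive_tac; ring.
  + intros u Hu; instantiate_fact X (psi_bounds u).
    assert (0 <= s * psi u ^ 2) by (apply Rmult_le_pos; nra).
    assert (0 <= A u ^ 2) by nra. nra.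
Qed.

(* [0.7923 >= (4/3) / 1.683], where [4/3] is the integral of [1 - a^2] over
   [[-1, 1]] and [A' >= 1.683]. *)
Lemma dpsi_right t : 0 <= t <= M -> - 0.7923 <= dpsi t <= 0.
Proof.
assert (unit_range : forall t, 0 <= t <= M -> A t <= 1 -> - 0.7923 <= dpsi t).
{ clear t; intros t Ht HA.
  (* The added term has derivative at least [1 - A^2], which outweighs [psi'' >= - (1 - A^2)]. *)
  assert (X : dpsi 0 + (A 0 - A 0 ^ 3 / 3) / 1.683
              <= dpsi t + (A t - A t ^ 3 / 3) / 1.683).
  { apply (nondecreasing_of_derive
      (fun u => dpsi u + (A u - A u ^ 3 / 3) / 1.683)
      (fun u => psi u * (s * psi u ^ 2 + A u ^ 2 - 1)
                + (1 - A u ^ 2) * (dA u / 1.683))); try lra.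
    - continuity_tac.
    - intros u Hu; derive_tac; field; lra.
    - intros u Hu; instantiate_fact X (psi_bounds u).
      instantiate_fact Y (A_ge' 0 u). instantiate_fact Z (A_ge' u t).
      instantiate_fact W (dA_ge u).
      assert (1 <= dA u / 1.683) by lra.
      assert (A0 := A_0_bounds).
      assert (- 1 <= A u <= 1) by lra.
      assert (0 <= 1 - A u ^ 2) by nra.
      assert (0 <= psi u * (s * psi u ^ 2)).
      { repeat apply Rmult_le_pos; try lra; nra. }
      nra. }
  rewrite (cs_dpsi_0 _ _ _ _ _ _ _ _ _ S) in X.
  instantiate_fact Y (A_ge' 0 t). assert (A0 := A_0_bounds).
  (* [a - a^3 / 3] has extrema -2/3 and 2/3 at -1 and 1, hence the double roots in the two
     factorizations. *)
  assert (A 0 - A 0 ^ 3 / 3 >= - 2 / 3).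
  { assert (0 <= (A 0 + 1) ^ 2 * (2 - A 0)); [|nra].
    apply Rmult_le_pos; [apply pow2_ge_0|lra]. }
  assert (A t - A t ^ 3 / 3 <= 2 / 3).
  { assert (0 <= (A t - 1) ^ 2 * (2 + A t)); [|nra].
    apply Rmult_le_pos; [apply pow2_ge_0|lra]. }
  lra. }
intros Ht; split.
- destruct (Rle_dec (A t) 1) as [H1|H1]; [apply unit_range; auto|].
  assert (C : continuity (fun u => A u - 1)) by (intros u; continuity_tac).
  assert (A0 := A_0_bounds).
  (* Beyond the point [v] where [A] reaches 1, [psi'' >= 0], so the bound at [v] persists. *)
  destruct (IVT_cor _ 0 t C) as [v [Hv Ev]]; [lra|nra|].
  apply Rle_trans with (dpsi v); [apply unit_range; lra|].
  apply (nondecreasing_of_derive dpsi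
    (fun u => psi u * (s * psi u ^ 2 + A u ^ 2 - 1))); try lra.
  + continuity_tac.
  + intros u Hu; derive_tac; ring.
  + intros u Hu; instantiate_fact X (psi_bounds u).
    instantiate_fact Y (A_ge' v u).
    apply Rmult_le_pos; [lra|].
    assert (0 <= s * psi u ^ 2) by (apply Rmult_le_pos; nra).
    assert (1 <= A u) by lra. nra.
- destruct (Req_dec t M) as [->|H1].
  { rewrite (cs_dpsi_right _ _ _ _ _ _ _ _ _ S); lra. }
  destruct (Req_dec t 0) as [->|H2].
  { rewrite (cs_dpsi_0 _ _ _ _ _ _ _ _ _ S); lra. }
  apply Rlt_le, (cs_decr _ _ _ _ _ _ _ _ _ S); lra.
Qed.

Lemma psi_left : 1 - m <= psi (- m).
Proof.
assert (- m - psi (- m) <= 0 - psi 0);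
  [|rewrite (cs_psi_0 _ _ _ _ _ _ _ _ _ S) in H; lra].
apply (nondecreasing_of_derive (fun u => u - psi u) (fun u => 1 - dpsi u)); try lra.
- continuity_tac.
- intros u Hu; derive_tac; ring.
- intros u Hu; instantiate_fact X (dpsi_left u); lra.
Qed.

(** * Integral bounds *)

(** One factor [psi'] integrates to a variation of [psi], at most [m] left of 0 and at most 1 right
    of it; the other [2 n + 1] factors are bounded pointwise. The cases [n = 0] and [n = 1] serve
    below. *)
Lemma RInt_dpsi_pow (n : nat) :
  RInt (fun t => dpsi t ^ (2 * Datatypes.S n)) (- m) M
    <= m + 0.7923 ^ (2 * n + 1).
Proof.
assert (C : forall t, continuity_pt (fun t => dpsi t ^ (2 * Datatypes.S n)) t).
{ continuity_tac. }
rewrite <- (RInt_Chasles _ (- m) 0 M) by (apply ex_RInt_continuity, C).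
change plus with Rplus; apply Rplus_le_compat.
- apply Rle_trans with (psi 0 - psi (- m)).
  + apply (RInt_le_of_derive psi dpsi); auto; try lra.
    * continuity_tac.
    * intros t Ht; apply (cs_psi _ _ _ _ _ _ _ _ _ S); lra.
    * intros t Ht; instantiate_fact X (dpsi_left t).
      replace (2 * Datatypes.S n)%nat with (Datatypes.S (2 * n + 1)) by lia.
      rewrite <- tech_pow_Rmult.
      assert (0 <= dpsi t ^ (2 * n + 1) <= 1); [|nra].
      split; [apply pow_le; lra|].
      rewrite <- (pow1 (2 * n + 1)); apply pow_incr; lra.
  + rewrite (cs_psi_0 _ _ _ _ _ _ _ _ _ S); assert (X := psi_left); lra.
- set (c := 0.7923 ^ (2 * n + 1)).
  apply Rle_trans with (- c * psi M
                        - - c * psi 0).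
  + apply (RInt_le_of_derive (fun t => - c * psi t)
      (fun t => - c * dpsi t)); auto; try lra.
    * continuity_tac.
    * intros t Ht; derive_tac; ring.
    * intros t Ht; instantiate_fact X (dpsi_right t).
      replace (dpsi t ^ (2 * Datatypes.S n)) with ((- dpsi t) ^ (Datatypes.S (2 * n + 1))).
      2: { replace (Datatypes.S (2 * n + 1)) with (2 * Datatypes.S n)%nat by lia.
           rewrite !pow_mult; f_equal; ring. }
      rewrite <- tech_pow_Rmult.
      replace (- c * dpsi t)
        with (- dpsi t * c) by ring.
      apply Rmult_le_compat_l; [lra|apply pow_incr; lra].
  + rewrite (cs_psi_0 _ _ _ _ _ _ _ _ _ S).
    instantiate_fact X (psi_bounds M).
    assert (0 <= c) by (apply pow_le; lra). nra.
Qed.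

Lemma flux_nonpos t : - m <= t <= M -> flux r s h dA t <= 0.
Proof.
intros Ht; instantiate_fact X (dA_le_h t); unfold flux.
apply Rmult_le_reg_r with (r * s); [nra|].
unfold Rdiv; rewrite Rmult_assoc, Rinv_l by nra; lra.
Qed.

(* Since [-B = (-t B)' + t psi^2 A], it is enough that [t psi^2 A] is bounded by
   [3 (psi psi')' + 6.25 (atan A)'], which integrates to at most [6.25 PI]. *)
Lemma RInt_flux : RInt (fun t => - flux r s h dA t) (- m) M <= 25.
Proof.
unfold flux.
apply Rle_trans with
 ((- M * ((dA M - h) / (r * s)) + 3 * (psi M * dpsi M) + 6.25 * atan (A M))
  - (- - m * ((dA (- m) - h) / (r * s)) + 3 * (psi (- m) * dpsi (- m))
     + 6.25 * atan (A (- m)))).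
- apply (RInt_le_of_derive
   (fun t => - t * ((dA t - h) / (r * s)) + 3 * (psi t * dpsi t) + 6.25 * atan (A t))
   (fun t => - ((dA t - h) / (r * s)) - t * (psi t ^ 2 * A t)
     + 3 * (dpsi t ^ 2 + psi t ^ 2 * (s * psi t ^ 2 + A t ^ 2 - 1))
     + 6.25 * (dA t / (1 + A t ^ 2)))).
  + lra.
  + continuity_tac.
  + continuity_tac.
  + intros t Ht; derive_tac.
    assert (0 < 1 + A t ^ 2) by (assert (0 <= A t ^ 2) by apply pow2_ge_0; lra).
    field; repeat split; nra.
  + intros t Ht.
    instantiate_fact P (psi2_bounds t).
    instantiate_fact D (dA_ge t).
    assert (A0 := A_0_bounds).
    (* Subtracting [3 (A^2 - 1)] from this bound leaves [4 - A^2], to be absorbed by the arctangent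
       term in [H2]. *)
    assert (H1 : t * A t <= 2 * A t ^ 2 + 1).
    { destruct (Rle_dec t 0) as [H|H].
      - assert (- 1 <= t * 1) by lra. assert (t * A t <= 1 * Rabs (A t)).
        { rewrite <- (Rabs_pos_eq 1) by lra.
          apply Rle_trans with (1 := Rle_abs _); rewrite Rabs_mult.
          apply Rmult_le_compat_r; [apply Rabs_pos|].
          rewrite (Rabs_pos_eq 1) by lra; apply Rabs_le; lra. }
        revert H1; unfold Rabs; destruct Rcase_abs; nra.
      - instantiate_fact G (A_ge' 0 t).
        destruct (Rle_dec 0 (A t)); nra. }
    assert (Q0 : 0 <= A t ^ 2) by apply pow2_ge_0.
    (* [(4 - x) (1 + x)] has maximum 6.25, at [x = 3 / 2], and [dA > 1]. *)
    assert (H2 : psi t ^ 2 * (4 - A t ^ 2) <= 6.25 * (dA t / (1 + A t ^ 2))).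
    { apply Rmult_le_reg_r with (1 + A t ^ 2); [lra|].
      replace (6.25 * (dA t / (1 + A t ^ 2)) * (1 + A t ^ 2))
        with (6.25 * dA t) by (field; lra).
      apply Rle_trans with (psi t ^ 2 * 6.25); [|nra].
      rewrite Rmult_assoc; apply Rmult_le_compat_l; [lra|].
      assert (0 <= (A t ^ 2 - 1.5) ^ 2) by apply pow2_ge_0. nra. }
    assert (H3 : 0 <= dpsi t ^ 2) by apply pow2_ge_0.
    assert (H4 : 0 <= s * (psi t ^ 2 * psi t ^ 2)).
    { apply Rmult_le_pos; [lra|apply Rmult_le_pos; lra]. }
    assert (H5 : psi t ^ 2 * (t * A t) <= psi t ^ 2 * (2 * A t ^ 2 + 1)).
    { apply Rmult_le_compat_l; lra. }
    lra.
- rewrite (cs_dA_left _ _ _ _ _ _ _ _ _ S), (cs_dA_right _ _ _ _ _ _ _ _ _ S),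
    (cs_dpsi_left _ _ _ _ _ _ _ _ _ S), (cs_dpsi_right _ _ _ _ _ _ _ _ _ S).
  assert (X := atan_bound (A M)); assert (Y := atan_bound (A (- m))).
  assert (Z := PI_4). unfold Rdiv; lra.
Qed.

(* With [y = -(1 - h t)] one has [A <= y + s + h m] on [[0, 1/h]], so
   [A^2 >= 2 A y - y^2] gives [psi'' >= y^2 - 1 - 2 (s + h m)], to be integrated
   twice. *)
Lemma psi_inv_h : 1 / h <= M /\ 0.9117 <= psi (1 / h).
Proof.
set (tau := 1 / h); set (e := s + h * m).
assert (Eh : h * tau = 1) by (unfold tau; field; lra).
assert (Ht : 0 < tau <= 0.5942).
{ assert (H0 : 0 < tau) by (apply Rdiv_lt_0_compat; lra); split; [exact H0|].
  assert (0 <= tau * (h - 1.6831)) by (apply Rmult_le_pos; lra). lra. }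
assert (A0 := A_0_bounds).
split; [lra|].
assert (D : forall t, 0 <= t <= tau ->
  - h * t ^ 2 + h ^ 2 * t ^ 3 / 3 - 2 * e * t <= dpsi t).
{ intros t H.
  assert (dpsi 0 - (- h * 0 ^ 2 + h ^ 2 * 0 ^ 3 / 3 - 2 * e * 0)
          <= dpsi t - (- h * t ^ 2 + h ^ 2 * t ^ 3 / 3 - 2 * e * t));
    [|rewrite (cs_dpsi_0 _ _ _ _ _ _ _ _ _ S) in H0; lra].
  apply (nondecreasing_of_derive
    (fun t => dpsi t - (- h * t ^ 2 + h ^ 2 * t ^ 3 / 3 - 2 * e * t))
    (fun t => psi t * (s * psi t ^ 2 + A t ^ 2 - 1)
              - ((1 - h * t) ^ 2 - 1 - 2 * e))); try lra.
  - continuity_tac.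
  - intros u Hu; derive_tac; field.
  - intros u Hu; instantiate_fact X (psi_bounds u).
    instantiate_fact Y (A_increment_le 0 u).
    assert (Hhu : 0 <= 1 - h * u <= 1) by nra.
    assert (Hy : A u <= - (1 - h * u) + e) by (unfold e; lra).
    assert (Hsq : (1 - h * u) ^ 2 - 2 * e <= A u ^ 2).
    { assert (0 <= (A u + (1 - h * u)) ^ 2) by apply pow2_ge_0.
      assert (0 <= (1 - h * u) * (- (1 - h * u) + e - A u)) by (apply Rmult_le_pos; lra).
      assert (0 <= e) by (unfold e; nra). nra. }
    assert (0 <= s * psi u ^ 2) by (apply Rmult_le_pos; nra).
    assert (0 <= e) by (unfold e; nra).
    assert (psi u * ((1 - h * u) ^ 2 - 1 - 2 * e)
            <= psi u * (s * psi u ^ 2 + A u ^ 2 - 1)).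
    { apply Rmult_le_compat_l; lra. }
    assert ((1 - h * u) ^ 2 - 1 - 2 * e <= 0) by nra. nra. }
assert (E : psi 0 - (- h * 0 ^ 3 / 3 + h ^ 2 * 0 ^ 4 / 12 - e * 0 ^ 2)
  <= psi tau - (- h * tau ^ 3 / 3 + h ^ 2 * tau ^ 4 / 12 - e * tau ^ 2)).
{ apply (nondecreasing_of_derive
    (fun t => psi t - (- h * t ^ 3 / 3 + h ^ 2 * t ^ 4 / 12 - e * t ^ 2))
    (fun t => dpsi t - (- h * t ^ 2 + h ^ 2 * t ^ 3 / 3 - 2 * e * t))); try lra.
  - continuity_tac.
  - intros u Hu; derive_tac; field.
  - intros u Hu; instantiate_fact X (D u); lra. }
rewrite (cs_psi_0 _ _ _ _ _ _ _ _ _ S) in E.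
(* With [h tau = 1] the lower bound becomes [1 - tau^2 / 4 - e tau^2]. *)
replace (h * tau ^ 3) with ((h * tau) * tau ^ 2) in E by ring.
replace (- h * tau ^ 3) with (- (h * tau) * tau ^ 2) in E by ring.
replace (h ^ 2 * tau ^ 4) with ((h * tau) ^ 2 * tau ^ 2) in E by ring.
rewrite Eh in E.
assert (tau ^ 2 <= 0.35308) by nra.
assert (0 <= e <= 2e-5) by (unfold e; nra).
assert (e * tau ^ 2 <= 2e-5 * 1) by (apply Rmult_le_compat; nra).
lra.
Qed.

(** Only [[0, 1/h]] is kept; [psi] decreases there, so its value at [1/h] is a lower bound. *)
Lemma RInt_psi4 : 0.9117 ^ 4 / h <= RInt (fun t => psi t ^ 4) (- m) M.
Proof.
destruct psi_inv_h as [HM Hpsi].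
assert (Ht : 0 < 1 / h) by (apply Rdiv_lt_0_compat; lra).
assert (C : forall t, continuity_pt (fun t => psi t ^ 4) t) by continuity_tac.
assert (I := fun a b => ex_RInt_continuity _ a b C).
rewrite <- (RInt_Chasles _ (- m) 0 M), <- (RInt_Chasles _ 0 (1 / h) M) by apply I.
change plus with Rplus.
assert (N : forall a b, a <= b -> - m <= a -> b <= M ->
  0 <= RInt (fun t => psi t ^ 4) a b).
{ intros a b Hab Ha Hb; apply RInt_ge_0; auto.
  intros t H; apply pow_le; instantiate_fact X (psi_bounds t); lra. }
instantiate_fact N1 (N (- m) 0); instantiate_fact N2 (N (1 / h) M).
assert (0.9117 ^ 4 / h <= RInt (fun t => psi t ^ 4) 0 (1 / h)); [|lra].
replace (0.9117 ^ 4 / h) with (RInt (fun _ => 0.9117 ^ 4) 0 (1 / h)).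
2: { rewrite RInt_const; change scal with Rmult; simpl; field; lra. }
apply RInt_le; [lra|apply ex_RInt_const|apply I|].
intros t H; apply pow_incr; split; [lra|].
apply Rle_trans with (1 := Hpsi), Ropp_le_cancel.
apply (nondecreasing_of_derive (fun u => - psi u) (fun u => - dpsi u)); try lra.
- continuity_tac.
- intros u Hu; derive_tac; ring.
- intros u Hu; instantiate_fact X (dpsi_right u); lra.
Qed.

(** * First integral and sign of the energy integral *)

(** The system is conservative. [K] is read off at [- m], where [B] and [psi'] vanish, and is nearly
    nonnegative because [A (- m)^2] is close to 1. *)
Lemma first_integral : exists K, s / 2 - K <= 1e-4 /\
  forall t, - m <= t <= M ->
    flux r s h dA t * (dA t + h)
    = psi t ^ 2 * (s * psi t ^ 2 + A t ^ 2 - 1) - dpsi t ^ 2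
      - (s * psi t ^ 4 / 2 - K).
Proof.
exists (psi (- m) ^ 2 * (1 - A (- m) ^ 2 - s * psi (- m) ^ 2 / 2)); split.
- assert (HA := A_left_bounds).
  instantiate_fact P (psi2_bounds (- m)).
  assert (A (- m) ^ 2 <= 1 + 2.1e-5) by nra.
  assert (0 <= s * psi (- m) ^ 2 <= s) by nra.
  assert (psi (- m) ^ 2 * (A (- m) ^ 2 - 1 + s * psi (- m) ^ 2 / 2)
          <= psi (- m) ^ 2 * 3e-5) by (apply Rmult_le_compat_l; lra).
  lra.
- intros t Ht; unfold flux.
  set (F := fun t => (dA t - h) / (r * s) * (dA t + h)
    - (psi t ^ 2 * (s * psi t ^ 2 + A t ^ 2 - 1) - dpsi t ^ 2 - s * psi t ^ 4 / 2)).
  assert (E : F (- m) = F t).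
  { apply constant_of_derive; [lra| |].
    - unfold F; continuity_tac.
    - intros u Hu; unfold F; derive_tac; field; split; lra. }
  unfold F in E.
  rewrite (cs_dA_left _ _ _ _ _ _ _ _ _ S), (cs_dpsi_left _ _ _ _ _ _ _ _ _ S) in E.
  unfold Rdiv in *; lra.
Qed.

Lemma energy_integral_neg :
  RInt (fun t => psi t ^ 2 * (s * psi t ^ 2 / 2 - 1 + A t ^ 2) + dpsi t ^ 2
                 + 1 / (r * s) * (dA t - h) ^ 2) (- m) M < 0.
Proof.
destruct first_integral as [K [HK E]].
set (u := 2 * h - 5 * s); assert (Hu : 0 < u) by (unfold u; lra).
set (I4 := fun t => dpsi t ^ 4); set (I2 := fun t => dpsi t ^ 2).
set (IB := fun t => - flux r s h dA t); set (Q := fun t => psi t ^ 4).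
(* [F] collects the exact derivatives left by the integrations by parts. *)
set (F := fun t => psi t * dpsi t / s
  + 2.01 / u * (flux r s h dA t * (psi t * dpsi t) - psi t ^ 4 * A t / 4
                - 2 / u * (psi t * dpsi t ^ 3 / 3))).
(* [W] holds the remainders that are not exact derivatives; their integrals are bounded by the
   preceding lemmas. *)
set (W := fun t => 2.01 / u * (2 / u * (4 / 3 * I4 t + 1e-4 * I2 t) + 1e-4 * IB t)
                   + (2.01 / u * (h / 4) - 1 / 2) * Q t).
assert (CW : forall t, continuity_pt W t).
{ unfold W, I4, I2, IB, Q, flux; continuity_tac. }
assert (HW : RInt W (- m) M =
  2.01 / u * (2 / u * (4 / 3 * RInt I4 (- m) M + 1e-4 * RInt I2 (- m) M)
              + 1e-4 * RInt IB (- m) M)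
  + (2.01 / u * (h / 4) - 1 / 2) * RInt Q (- m) M).
{ assert (Sc : forall c f, (forall t, continuity_pt f t) ->
    RInt (fun t => c * f t) (- m) M = c * RInt f (- m) M).
  { intros c f Hf; apply (RInt_scal (V := R_CompleteNormedModule) f).
    apply ex_RInt_continuity, Hf. }
  assert (Pl : forall f g, (forall t, continuity_pt f t) ->
    (forall t, continuity_pt g t) ->
    RInt (fun t => f t + g t) (- m) M = RInt f (- m) M + RInt g (- m) M).
  { intros f g Hf Hg; apply (RInt_plus (V := R_CompleteNormedModule) f g);
      apply ex_RInt_continuity; assumption. }
  unfold W; repeat first
    [ rewrite Sc by (unfold I4, I2, IB, Q, flux; continuity_tac)
    | rewrite Pl by (unfold I4, I2, IB, Q, flux; continuity_tac) ].
  reflexivity. }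
assert (HN : RInt (fun t => psi t ^ 2 * (s * psi t ^ 2 / 2 - 1 + A t ^ 2)
    + dpsi t ^ 2 + 1 / (r * s) * (dA t - h) ^ 2) (- m) M
  <= s * (F M + RInt W (- m) M) - s * (F (- m) + RInt W (- m) (- m))).
{ apply (RInt_le_of_derive (fun t => s * (F t + RInt W (- m) t))
    (fun t =>
      let q := s * psi t ^ 2 + A t ^ 2 - 1 in
      s * ((dpsi t ^ 2 + psi t ^ 2 * q) / s
        + 2.01 / u * (flux r s h dA t * (dpsi t ^ 2 + psi t ^ 2 * q)
            - psi t ^ 4 * dA t / 4
            - 2 / u * (dpsi t ^ 4 / 3 + psi t ^ 2 * q * dpsi t ^ 2))
        + W t))).
  - lra.
  - intros t; apply (continuity_pt_mult (fun _ => s) (fun t => F t + RInt W (- m) t)).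
    + continuity_tac.
    + apply (continuity_pt_plus F (RInt W (- m))).
      * unfold F, flux; continuity_tac.
      * apply derivable_continuous_pt; exists (W t).
        apply is_derive_Reals, is_derive_RInt_continuity, CW.
  - continuity_tac.
  - intros t Ht; cbv zeta.
    apply (is_derive_scal (fun t => F t + RInt W (- m) t)).
    apply (is_derive_plus F (RInt W (- m))); [|apply is_derive_RInt_continuity, CW].
    unfold F, flux; derive_tac; field; repeat split; lra.
  - intros t Ht; cbv zeta.
    set (q := s * psi t ^ 2 + A t ^ 2 - 1).
    instantiate_fact P (psi2_bounds t).
    instantiate_fact D1 (dA_ge t). instantiate_fact D2 (dA_le_h t).
    instantiate_fact B0 (flux_nonpos t). instantiate_fact Et (E t).
    assert (HB := B_square_bound r 2.01 u 1e-4 h (flux r s h dA t) (psi t) (dpsi t)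
      (dA t) q (s * psi t ^ 4 / 2 - K)).
    replace (psi t ^ 2 * (s * psi t ^ 2 / 2 - 1 + A t ^ 2) + dpsi t ^ 2
             + 1 / (r * s) * (dA t - h) ^ 2)
      with (s * ((dpsi t ^ 2 + psi t ^ 2 * q) / s - psi t ^ 4 / 2
                 + r * flux r s h dA t ^ 2))
      by (unfold q, flux; field; lra).
    apply Rmult_le_compat_l; [lra|].
    assert (Hu1 : u <= dA t + h) by (unfold u; lra).
    assert (Hc : s * psi t ^ 4 / 2 - K <= 1e-4).
    { assert (psi t ^ 4 <= 1) by nra. nra. }
    specialize (HB ltac:(lra) ltac:(lra) Hu Hu1 D2 B0 Hc Et).
    unfold W, I4, I2, IB, Q.
    unfold Rdiv in *; lra. }
rewrite RInt_point in HN; change zero with 0 in HN.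
apply Rle_lt_trans with (1 := HN).
(* [B] and [psi'] vanish at both ends, so only [psi^4 A / 4] survives: its value at [M] has a
   favourable sign, and its value at [- m] supplies the decisive negative term, near -1/4. *)
assert (HF : F M - F (- m) <= 2.01 / u * (psi (- m) ^ 4 * A (- m) / 4)).
{ destruct A_sign as [z [Hz [Ez [_ [Hpos _]]]]].
  instantiate_fact AM (Hpos M).
  instantiate_fact PM (psi_bounds M).
  assert (0 <= 2.01 / u * (psi M ^ 4 * A M)).
  { apply Rmult_le_pos; [apply Rlt_le, Rdiv_lt_0_compat; lra|].
    apply Rmult_le_pos; [apply pow_le; lra|exact AM]. }
  unfold F, flux.
  rewrite (cs_dA_left _ _ _ _ _ _ _ _ _ S), (cs_dA_right _ _ _ _ _ _ _ _ _ S),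
    (cs_dpsi_left _ _ _ _ _ _ _ _ _ S), (cs_dpsi_right _ _ _ _ _ _ _ _ _ S).
  unfold Rdiv in *; lra. }
assert (HP : psi (- m) ^ 4 * A (- m) <= - (1 - m) ^ 4 * (1 - s)).
{ assert (HA := A_left_bounds).
  assert ((1 - m) ^ 4 <= psi (- m) ^ 4) by (apply pow_incr; split; [lra|apply psi_left]).
  assert (0 <= (1 - m) ^ 4) by (apply pow_le; lra). nra. }
assert (H4 := RInt_dpsi_pow 1); assert (H2 := RInt_dpsi_pow 0).
simpl Nat.mul in H4, H2; simpl Nat.add in H4, H2; rewrite pow_1 in H2.
assert (L := final_numeric_bound s m h u (RInt I4 (- m) M) (RInt I2 (- m) M)
  (RInt IB (- m) M) (RInt Q (- m) M) (psi (- m) ^ 4 * A (- m))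
  s_bounds (conj m_pos m_small) h_gt eq_refl H4 H2 RInt_flux RInt_psi4 HP).
rewrite HW in *; nra.
Qed.

End Estimates.

(** * Passage to small [beta] *)

Theorem theorem3 :
  exists gamma : R, 0 < gamma /\
  forall r : R, 0 < r < 2 + gamma ->
  forall (m M h : R -> R) (psi dpsi A dA : R -> R -> R),
    asymmetric_family r m M h psi dpsi A dA ->
    at_right 0 (fun beta : R =>
      energy r beta (m beta) (M beta) (h beta)
        (psi beta) (dpsi beta) (A beta) (dA beta) < 0).
Proof.
exists 0.01; split; [lra|].
intros r Hr m M h psi dpsi A dA [Hsol Hm HM [h0 [Hh0 Hh]]].
(* Eventually [h < h0 + 1], so this radius for [m] yields [h m <= 1e-5]. *)
assert (Hd : 0 < 1e-5 / (h0 + 1)) by (apply Rdiv_lt_0_compat; lra).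
assert (Em := Hm _ (locally_ball 0 (mkposreal _ Hd))).
assert (EM := HM _ (ex_intro (fun K => forall x, K < x -> 1 < x) 1 (fun x H => H))).
assert (Eh := Hh _ (locally_ball h0 (mkposreal 1 Rlt_0_1))).
assert (Eb : at_right 0 (fun beta => 0 < beta < 1e-3)).
{ assert (H3 : 0 < 1e-3) by lra.
  exists (mkposreal _ H3); intros b Hb Hb0.
  unfold ball in Hb; simpl in Hb; unfold AbsRing_ball, abs, minus, plus, opp in Hb.
  simpl in Hb; apply Rabs_def2 in Hb; lra. }
unfold filtermap in Em, EM, Eh.
generalize (filter_and _ _ Hsol (filter_and _ _ Em (filter_and _ _ EM
  (filter_and _ _ Eh Eb)))).
apply filter_imp; clear Hsol Hm HM Hh Em EM Eh Eb.
intros b [Hs [Hm [HM [Hh Hb]]]].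
unfold ball in Hm, Hh; simpl in Hm, Hh.
unfold AbsRing_ball, abs, minus, plus, opp in Hm, Hh; simpl in Hm, Hh.
rewrite (as_bc_A_left _ _ _ _ _ _ _ _ _ Hs) in Hh.
apply Rabs_def2 in Hm; apply Rabs_def2 in Hh.
assert (m_pos := as_m_pos _ _ _ _ _ _ _ _ _ Hs).
assert (h_gt := as_h_gt _ _ _ _ _ _ _ _ _ Hs).
assert (Hhm : h b * m b <= 1e-5).
{ replace 1e-5 with ((h0 + 1) * (1e-5 / (h0 + 1))) by (field; lra).
  apply Rmult_le_compat; lra. }
assert (Hr' : 0 < r < 2.01) by lra.
assert (Hb2 : b ^ 2 <= 1e-5) by nra.
assert (HM1 : 1 <= M b) by lra.
assert (N := energy_integral_neg _ _ _ _ _ _ _ _ _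
  (clamped_solution_of_asymmetric _ _ _ _ _ _ _ _ _ Hr' (proj1 Hb) Hb2 Hhm HM1 Hs)).
unfold energy.
rewrite <- (Rmult_0_r (b ^ 2 / (2 * (m b + M b)))); apply Rmult_lt_compat_l.
{ apply Rdiv_lt_0_compat; [apply pow_lt|]; lra. }
(* Inside the interval the clamped functions are the original ones, so the integrals agree. *)
refine (eq_ind _ (fun x => x < 0) N _ (RInt_ext _ _ _ _ _)).
rewrite Rmin_left, Rmax_right by lra.
intros t Ht; cbv beta; rewrite clamp_id by lra; reflexivity.
Qed.
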